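(* Let $G=(V,E)$ be a locally finite (unweighted) graph and let $x\in V$. Then the scalar curvature $\kappa(x)$ at $x$ is controlled by the local clustering coefficient $c(x)$ at $x$: $$\frac{d_x-1}{d_x}\,c(x)\geq\kappa(x)\geq-2+\frac{d_x-1}{d_x\vee D(x)}\,c(x).$$
   Context: Graphs $G=(V,E)$ are undirected, connected, simple, without loops; $V$ may be infinite; locally finite means every vertex has finitely many neighbors. $x\sim y$ means $x,y$ are neighbors, and $d_x$ is the degree (number of neighbors) of $x$. $d$ is the graph distance (number of edges of a shortest path). For each vertex $x$, $m_x$ is the probability measure on $V$ with $m_x(y)=1/d_x$ if $y\sim x$ and $m_x(y)=0$ otherwise. $W_1(\mu_1,\mu_2)=\inf_\xi\sum_{x',y'}d(x',y')\xi(x',y')$, the infimum over all probability measures $\xi$ on $V\times V$ with marginals $\mu_1$ and $\mu_2$. The Ollivier-Ricci curvature is $\kappa(x,y)=1-\frac{W_1(m_x,m_y)}{d(x,y)}$ for $x\neq y$. The scalar curvature at $x$ is $\kappa(x)=\frac{1}{d_x}\sum_{y:\,y\sim x}\kappa(x,y)$. The local clustering coefficient $c(x)$ is the number of edges between neighbors of $x$ divided by the number of possible existing edges between neighbors of $x$; it satisfies $c(x)=\frac{1}{d_x(d_x-1)}\sum_{y:\,y\sim x}\sharp(x,y)$, where, for $x\sim y$, $\sharp(x,y)$ is the number of triangles which include $x,y$ as vertices, i.e. the number of vertices $x_1$ with $x_1\sim x$ and $x_1\sim y$. $D(x)=\max_{y:\,y\sim x}d_y$, and $s\vee t=\max(s,t)$.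 *)

(* Defs.v *)
From HB Require Import structures.
From mathcomp Require Import all_boot all_order all_algebra.
From mathcomp Require Import finmap.
From mathcomp Require Import all_classical all_reals.
From mathcomp Require Import ereal esum.

Set Implicit Arguments.
Unset Strict Implicit.
Unset Printing Implicit Defensive.

Import Order.TTheory GRing.Theory Num.Theory.

Local Open Scope classical_set_scope.
Local Open Scope ring_scope.

(* Undirected, simple, loopless, connected; [V] may be infinite. *)
Record graph (V : choiceType) := Graph {
  adj : rel V;
  adj_sym : symmetric adj;
  adj_irr : irreflexive adj;
  adj_conn : forall x y : V, exists p : seq V, path adj x p /\ last x p = y
}.

Section Graph.
Context {V : choiceType} (G : graph V).

Definition locally_finite : Prop :=
  forall x : V, finite_set [set y | adj G x y].

(* [fset_set] is the empty set on infinite sets, so [nbrs], and everything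
   built on it, is meaningful for locally finite graphs only. *)
Definition nbrs (x : V) : {fset V} := fset_set [set y | adj G x y].

Definition deg (x : V) : nat := #|` nbrs x|.

Definition max_nbr_deg (x : V) : nat := \max_(y <- nbrs x) deg y.

Definition joined (x y : V) (n : nat) : bool :=
  `[< exists p : seq V, [/\ path (adj G) x p, last x p = y & size p = n] >].

Lemma joined_ex (x y : V) : exists n, joined x y n.
Proof.
have [p [hp hl]] := adj_conn G x y.
by exists (size p); apply/asboolP; exists p.
Qed.

Definition dist (x y : V) : nat := ex_minn (joined_ex x y).

Definition is_edge (e : {fset V}) : bool :=
  `[< exists y z : V, adj G y z /\ e = [fset y; z]%fset >].

Definition nbr_edges (x : V) : {fset {fset V}} :=
  [fset e in fpowerset (nbrs x) | is_edge e]%fset.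

Section Curvature.
Context (R : realType).

(* For [deg x <= 1] there is no possible edge and the value is [0 / 0 = 0]. *)
Definition clustering (x : V) : R := #|` nbr_edges x|%:R / 'C(deg x, 2)%:R.

Definition nbr_measure (x : V) : V -> R :=
  fun y => if adj G x y then (deg x)%:R^-1 else 0.

(* Probability measures on the discrete spaces [V] and [V * V] are given by
   their mass functions. *)
Definition couplings (mu1 mu2 : V -> R) : set (V * V -> R) :=
  [set xi | [/\ forall p, 0 <= xi p,
                (\esum_(p in [set: V * V]) (xi p)%:E = 1)%E,
                forall u, (\esum_(v in [set: V]) (xi (u, v))%:E = (mu1 u)%:E)%E
              & forall v, (\esum_(u in [set: V]) (xi (u, v))%:E = (mu2 v)%:E)%E]].

Definition W1 (mu1 mu2 : V -> R) : \bar R :=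
  ereal_inf [set (\esum_(p in [set: V * V]) ((dist p.1 p.2)%:R * xi p)%:E)%E
            | xi in couplings mu1 mu2].

(* Meaningful for [x != y] only.  Extended-real valued, as [W1] is, so that no
   default value is attached to an infinite transport cost. *)
Definition curvature (x y : V) : \bar R :=
  (1 - W1 (nbr_measure x) (nbr_measure y) * ((dist x y)%:R^-1)%:E)%E.

Definition scalar_curvature (x : V) : \bar R :=
  (((deg x)%:R^-1)%:E * \sum_(y <- nbrs x) curvature x y)%E.

End Curvature.
End Graph.

(* Main.v *)
Require Import Defs.
From HB Require Import structures.
From mathcomp Require Import all_boot all_order all_algebra.
From mathcomp Require Import finmap.
From mathcomp Require Import all_classical all_reals.
From mathcomp Require Import ereal esum.
From mathcomp Require Import lra.

Import Order.TTheory GRing.Theory Num.Theory.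

(** Both bounds come from one quantity, the mass that [m_x] and [m_y] have in
    common for [x ~ y]:
      [ov(x, y) = \sum_u min (m_x u) (m_y u) = #(x, y) / max (d_x, d_y)],
    where [#(x, y)] is the number of common neighbours
    ([sum_min_nbr_measure]).

    A coupling carries at most [min (mu1 u) (mu2 u)] on the diagonal point
    [(u, u)], and all the remaining mass travels a distance at least 1; hence
    [W1 >= 1 - ov] ([W1_ge]).  Conversely the common mass can be left in place
    and the rest transported in any way, at a cost at most the largest distance
    between the supports per unit of mass; this distance is at most 3 for
    neighbours of two adjacent vertices, hence [W1 <= 3 (1 - ov)] ([W1_le]).
    As [d(x, y) = 1], this gives [-2 + 3 ov <= kappa(x, y) <= ov]
    ([curvature_bounds]).

    To average over [y ~ x], replace [max (d_x, d_y)] by its lower bound [d_x]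
    in the upper estimate, and by its upper bound [max (d_x, D(x))] in the
    lower one, where [3 ov] is also weakened to [ov].  Both averages are then
    multiples of [\sum_(y ~ x) #(x, y)].  This sum counts every edge between
    neighbours of [x] twice ([sum_card_common_nbrs]), so it equals
    [d_x (d_x - 1) c(x)] ([clustering_common_nbrs]). *)
Local Open Scope ring_scope.

(** * Sums over discrete spaces *)

Section DiscreteSums.
Set Implicit Arguments.
Unset Strict Implicit.
Local Open Scope classical_set_scope.
Context (R : realType).

Lemma esum_fsupp (T : choiceType) (C : {fset T}) (f : T -> R) :
  (forall v, 0 <= f v) -> (forall v, v \notin C -> f v = 0) ->
  (\esum_(v in [set: T]) (f v)%:E = (\sum_(v <- C) f v)%:E)%E.
Proof.
move=> f0 fC.
have -> : (\esum_(v in [set: T]) (f v)%:E = \esum_(v in [set` C]) (f v)%:E)%E.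
  rewrite [RHS]esum_mkcond; apply: eq_esum => v _.
  by rewrite mem_setE; case: ifPn => // /fC ->.
rewrite esum_fset; last by move=> i _; rewrite lee_fin.
  by rewrite fsbig_finite // set_fsetK sumEFin.
exact: finite_fset.
Qed.

Lemma esum_pair (T : choiceType) (f : T * T -> R) :
  (forall p, 0 <= f p) ->
  (\esum_(p in [set: T * T]) (f p)%:E
   = \esum_(u in [set: T]) \esum_(v in [set: T]) (f (u, v))%:E)%E.
Proof.
move=> f0; rewrite (esum_esum (a := fun u v => (f (u, v))%:E)); last first.
  by move=> u v _ _; rewrite lee_fin.
have -> : [set: T] `*`` (fun=> [set: T]) = [set: T * T] by apply/seteqP; split.
by apply: eq_esum => -[].
Qed.

Lemma sum_indic (T : choiceType) (C : {fset T}) (u : T) (a : T -> R) :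
  (u \notin C -> a u = 0) -> \sum_(v <- C) (u == v)%:R * a u = a u.
Proof.
have [uC _|uC /(_ isT) a0] := boolP (u \in C); last first.
  by rewrite a0 big1 // => v _; rewrite mulr0.
rewrite (big_fsetD1 u uC) /= eqxx mul1r big_seq big1 ?addr0 // => v.
by rewrite in_fsetD1 eq_sym => /andP[/negbTE-> _]; rewrite mul0r.
Qed.

(** Dividing by the total mass [s] is harmless even when [s = 0], because a
    nonnegative function of total mass 0 vanishes. *)
Lemma mass_divK (T : choiceType) (C : {fset T}) (r : T -> R) (s : R) :
  (forall u, 0 <= r u) -> (forall u, u \notin C -> r u = 0) ->
  \sum_(u <- C) r u = s -> forall u, r u * (s / s) = r u.
Proof.
move=> r0 rC rs u; have [s0|s0] := eqVneq s 0; last by rewrite divff // mulr1.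
have [uC|/rC ->] := boolP (u \in C); last by rewrite mul0r.
suff -> : r u = 0 by rewrite mul0r.
apply/eqP; rewrite eq_le r0 andbT -s0 -rs (big_fsetD1 u uC) /=.
by rewrite lerDl sumr_ge0.
Qed.

End DiscreteSums.

(** * Transport cost and overlap of two measures *)

Section Transport.
Set Implicit Arguments.
Unset Strict Implicit.
Local Open Scope classical_set_scope.
Context (R : realType) (V : choiceType) (G : graph V).
Implicit Types (mu : V -> R) (C : {fset V}).

Lemma dist_le x (p : seq V) :
  path (adj G) x p -> (dist G x (last x p) <= size p)%N.
Proof.
move=> xp; rewrite /dist; case: ex_minnP => n _; apply.
by apply/asboolP; exists p.
Qed.

Lemma dist_gt0 u v : u != v -> (0 < dist G u v)%N.
Proof.
rewrite /dist; case: ex_minnP => -[|m] // /asboolP[p [_ pl p0]] _.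
by move: pl; rewrite (size0nil p0) /= => ->; rewrite eqxx.
Qed.

(** The coupling leaves the common part [a] of the two measures in place and
    moves the excess [r1 = mu1 - a] onto the deficit [r2 = mu2 - a] by the
    product measure [r1 r2 / s], where [s] is the mass of either.  Only the
    second part, of mass [s], has a cost. *)
Lemma W1_le mu1 mu2 C (D : R) :
    (forall u, 0 <= mu1 u) -> (forall u, 0 <= mu2 u) ->
    (forall u, u \notin C -> mu1 u = 0) ->
    (forall u, u \notin C -> mu2 u = 0) ->
    \sum_(u <- C) mu1 u = 1 -> \sum_(u <- C) mu2 u = 1 ->
    0 <= D -> (forall u v, mu1 u != 0 -> mu2 v != 0 -> (dist G u v)%:R <= D) ->
  (W1 G mu1 mu2
     <= (D * (1 - \sum_(u <- C) Num.min (mu1 u) (mu2 u)))%:E)%E.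
Proof.
move=> mu1_ge0 mu2_ge0 mu1C mu2C mu1_1 mu2_1 D_ge0 distD.
pose a u := Num.min (mu1 u) (mu2 u).
have a0 u : 0 <= a u by rewrite le_min mu1_ge0 mu2_ge0.
have aC u : u \notin C -> a u = 0.
  by move=> uC; rewrite /a mu1C // mu2C // minxx.
pose r1 u := mu1 u - a u; pose r2 u := mu2 u - a u.
have r1_ge0 u : 0 <= r1 u by rewrite subr_ge0 ge_min lexx.
have r2_ge0 u : 0 <= r2 u by rewrite subr_ge0 ge_min lexx orbT.
have r1C u : u \notin C -> r1 u = 0.
  by move=> uC; rewrite /r1 mu1C // aC // subrr.
have r2C u : u \notin C -> r2 u = 0.
  by move=> uC; rewrite /r2 mu2C // aC // subrr.
have r1_mu1 u : mu1 u = 0 -> r1 u = 0.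
  move=> m0; apply/eqP; rewrite eq_le r1_ge0 andbT.
  by rewrite /r1 m0 sub0r oppr_le0.
have r2_mu2 u : mu2 u = 0 -> r2 u = 0.
  move=> m0; apply/eqP; rewrite eq_le r2_ge0 andbT.
  by rewrite /r2 m0 sub0r oppr_le0.
set s := 1 - _.
have r1_s : \sum_(u <- C) r1 u = s by rewrite sumrB mu1_1.
have r2_s : \sum_(u <- C) r2 u = s by rewrite sumrB mu2_1.
have s_ge0 : 0 <= s by rewrite -r1_s sumr_ge0.
have r1_ss u : r1 u * (s / s) = r1 u by exact: (mass_divK (C := C)).
have r2_ss u : r2 u * (s / s) = r2 u by exact: (mass_divK (C := C)).
pose xi (p : V * V) : R :=
  (p.1 == p.2)%:R * a p.1 + r1 p.1 * r2 p.2 / s.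
have rest_ge0 u v : 0 <= r1 u * r2 v / s by rewrite divr_ge0 // mulr_ge0.
have xi_ge0 p : 0 <= xi p.
  by apply: addr_ge0; [rewrite mulr_ge0 ?ler0n|exact: rest_ge0].
have xi_row u : (\esum_(v in [set: V]) (xi (u, v))%:E = (mu1 u)%:E)%E.
  rewrite (esum_fsupp (C := C)) //; last first.
    move=> v vC; rewrite /xi /= r2C // mulr0 mul0r addr0.
    by have [->|_] := eqVneq u v; rewrite ?mul0r ?aC ?mulr0.
  rewrite big_split /= sum_indic; last exact: aC.
  by rewrite -mulr_suml -mulr_sumr r2_s -mulrA r1_ss /r1 addrC subrK.
have xi_col v : (\esum_(u in [set: V]) (xi (u, v))%:E = (mu2 v)%:E)%E.
  rewrite (esum_fsupp (C := C)) //; last first.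
    move=> u uC; rewrite /xi /= r1C // !mul0r addr0.
    by rewrite aC // mulr0.
  have -> : \sum_(u <- C) xi (u, v)
          = \sum_(u <- C) ((v == u)%:R * a v + r2 v / s * r1 u).
    apply: eq_bigr => u _; rewrite /xi /= [v == u]eq_sym; congr (_ + _).
      by have [->|] := eqVneq u v; rewrite ?mul0r.
    by rewrite mulrAC mulrC mulrA mulrAC.
  rewrite big_split /= sum_indic; last exact: aC.
  by rewrite -mulr_sumr r1_s -mulrA [_^-1 * _]mulrC r2_ss /r2 addrC subrK.
have xi_coupling : couplings mu1 mu2 xi.
  split=> //; rewrite esum_pair //; under eq_esum => u _ do rewrite xi_row.
  by rewrite (esum_fsupp (C := C)) // mu1_1.
(* It suffices to compare the cost pointwise with [D] times the moved part,
   whose total mass is [s * s / s = s]. *)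
apply: le_trans (_ : \esum_(p in [set: V * V])
                       (D * (r1 p.1 * r2 p.2 / s))%:E <= _)%E; last first.
  rewrite (esum_pair (f := fun p => D * (r1 p.1 * r2 p.2 / s))); last first.
    by move=> p; rewrite mulr_ge0.
  under eq_esum => u _.
    rewrite (esum_fsupp (C := C)) /=; last first.
    - by move=> v /r2C ->; rewrite mulr0 mul0r mulr0.
    - by move=> v; rewrite mulr_ge0.
    rewrite -mulr_sumr -mulr_suml -mulr_sumr r2_s -mulrA r1_ss.
    over.
  rewrite (esum_fsupp (C := C)) => [|u|u /r1C ->]; rewrite ?mulr0 ?mulr_ge0 //.
  by rewrite -mulr_sumr r1_s.
apply: le_trans (ereal_inf_lbound _) _; first by exists xi.
apply: le_esum => -[u v] _ /=; rewrite lee_fin /xi /=.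
have [<-|uv] := eqVneq u v.
  suff -> : dist G u u = 0%N by rewrite mul0r mulr_ge0.
  by apply/eqP; rewrite -leqn0; exact: (@dist_le u [::]).
rewrite mul0r add0r.
have [/r1_mu1 ->|m1] := eqVneq (mu1 u) 0; first by rewrite !mul0r !mulr0.
have [/r2_mu2 ->|m2] := eqVneq (mu2 v) 0; first by rewrite mulr0 mul0r !mulr0.
by rewrite ler_wpM2r // distD.
Qed.

(** Off the diagonal the distance is at least 1, so the cost of a coupling plus
    its mass on the diagonal is at least 1; the diagonal mass at [(u, u)] is
    bounded by both marginals at [u]. *)
Lemma W1_ge mu1 mu2 C :
    (forall u, 0 <= mu1 u) -> (forall u, 0 <= mu2 u) ->
    (forall u, u \notin C -> Num.min (mu1 u) (mu2 u) = 0) ->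
  ((1 - \sum_(u <- C) Num.min (mu1 u) (mu2 u))%:E <= W1 G mu1 mu2)%E.
Proof.
move=> mu1_ge0 mu2_ge0 minC.
apply: le_ereal_inf_tmp => _ [xi [xi0 xi1 xir xic] <-].
rewrite EFinB leeBlDr // -xi1.
have diag0 p : 0 <= (p.1 == p.2)%:R * xi p by rewrite mulr_ge0 ?ler0n.
have cost0 p : 0 <= (dist G p.1 p.2)%:R * xi p by rewrite mulr_ge0 ?ler0n.
apply: le_trans (_ : \esum_(p in [set: V * V])
   (((dist G p.1 p.2)%:R * xi p)%:E + ((p.1 == p.2)%:R * xi p)%:E) <= _)%E.
  apply: le_esum => -[u v] _ /=; rewrite -EFinD lee_fin -mulrDl ler_peMl //.
  rewrite -natrD ler1n; have [//|/dist_gt0 uv] := eqVneq u v.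
    by rewrite addn1.
  by rewrite addn0.
rewrite esumD; [|by move=> p _; rewrite lee_fin..].
rewrite leeD2l // esum_pair // -(esum_fsupp (C := C)) //; last first.
  by move=> u; rewrite le_min mu1_ge0 mu2_ge0.
apply: le_esum => u _.
have -> : (\esum_(v in [set: V]) ((u == v)%:R * xi (u, v))%:E
         = (xi (u, u))%:E)%E.
  rewrite (esum_fsupp (C := [fset u]%fset)).
  - by rewrite big_seq_fset1 eqxx mul1r.
  - by move=> v; exact: (diag0 (u, v)).
  - by move=> v; rewrite in_fset1 eq_sym => /negbTE ->; rewrite mul0r.
have le_esum1 (f : V -> R) : (forall v, 0 <= f v) ->
    ((f u)%:E <= \esum_(v in [set: V]) (f v)%:E)%E.
  move=> f0; rewrite -(esum_set1 (t := u) (a := fun v => (f v)%:E)) ?lee_fin //.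
  rewrite esum_mkcond; apply: le_esum => v _.
  by case: ifP => _; rewrite lee_fin.
rewrite lee_fin le_min; apply/andP; split.
  by rewrite -lee_fin -xir; apply: (le_esum1 (fun v => xi (u, v))).
by rewrite -lee_fin -xic; apply: (le_esum1 (fun v => xi (v, u))).
Qed.

End Transport.

(** * Triangles and curvature *)

Section Curvature.
Local Open Scope classical_set_scope.
Set Implicit Arguments.
Unset Strict Implicit.
Context (V : choiceType) (G : graph V).
Context (hG : locally_finite G).
Implicit Types (x y z : V).

Definition common_nbrs x y : {fset V} := (nbrs G x `&` nbrs G y)%fset.

Lemma in_nbrs x y : (y \in nbrs G x) = adj G x y.
Proof.
rewrite /nbrs in_fset_set; last exact: hG.
by apply/idP/idP; [rewrite inE|move=> h; rewrite inE].
Qed.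

Lemma deg_gt0 x y : adj G x y -> (0 < deg G x)%N.
Proof.
by move=> xy; rewrite cardfs_gt0; apply/fset0Pn; exists y; rewrite in_nbrs.
Qed.

Lemma card_common_nbrs_le x y :
  y \in nbrs G x -> (#|` common_nbrs x y| <= (deg G x).-1)%N.
Proof.
move=> xy; rewrite /deg (cardfsD1 y (nbrs G x)) xy add1n /=.
apply: fsubset_leq_card; apply/fsubsetP => z; rewrite !inE !in_nbrs.
move=> /andP[-> yz]; rewrite andbT.
by apply: contraTneq yz => ->; rewrite adj_irr.
Qed.

Lemma nbr_edgesP x e :
  reflect (exists y z, [/\ adj G x y, adj G x z, adj G y z
                         & e = [fset y; z]%fset])
          (e \in nbr_edges G x).
Proof.
rewrite /nbr_edges !inE /= fpowersetE; apply: (iffP andP).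
  move=> [/fsubsetP ex /asboolP[y [z [yz eyz]]]]; exists y, z.
  have [xy xz] : y \in nbrs G x /\ z \in nbrs G x.
    by split; apply: ex; rewrite eyz in_fset2 eqxx ?orbT.
  by move: xy xz; rewrite !in_nbrs.
move=> [y [z [xy xz yz ->]]]; split; last by apply/asboolP; exists y, z.
by apply/fsubsetP => t; rewrite !inE => /orP[]/eqP->; rewrite in_nbrs.
Qed.

(** The edges at [y] are the pairs [{y, z}] with [z] a common neighbour, and
    [z] is recovered from the pair because [z != y]. *)
Lemma card_nbr_edges_at x y : y \in nbrs G x ->
  #|` [fset e in nbr_edges G x | y \in e]%fset| = #|` common_nbrs x y|.
Proof.
rewrite in_nbrs => xy.
move: (nbr_edges G x) (nbr_edgesP x) => E EP.
have -> : [fset e in E | y \in e]%fset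
        = [fset [fset y; z] | z in common_nbrs x y]%fset.
  apply/fsetP => e; rewrite !inE /=; apply/andP/imfsetP => /=.
    move=> [/EP[a [b [xa xb ab ->]]]]; rewrite !inE => /orP[]/eqP yE.
      by exists b; rewrite ?inE ?in_nbrs ?yE ?xb.
    exists a; last by rewrite yE fsetUC.
    by rewrite ?inE ?in_nbrs ?yE ?xa adj_sym.
  move=> [z]; rewrite !inE !in_nbrs => /andP[xz yz] ->.
  by split; rewrite ?inE ?eqxx //; apply/EP; exists y, z.
rewrite card_in_imfset //= => a b; rewrite !inE !in_nbrs.
move=> /andP[_ ya] _ /fsetP/(_ a); rewrite !inE eqxx orbT.
case/esym/orP => /eqP // ay.
by move: ya; rewrite ay adj_irr.
Qed.

(** Double counting of the incidences between neighbours of [x] and the edges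
    joining them. *)
Lemma sum_card_common_nbrs x :
  (\sum_(y <- nbrs G x) #|` common_nbrs x y| = 2 * #|` nbr_edges G x|)%N.
Proof.
transitivity (\sum_(y <- nbrs G x) \sum_(e <- nbr_edges G x) (y \in e : nat))%N.
  rewrite big_seq [RHS]big_seq; apply: eq_bigr => y xy.
  rewrite -card_nbr_edges_at // card_fset_sum1 -big_fset_condE /= big_mkcond.
  by apply: eq_bigr => e _; case: (y \in e).
rewrite exchange_big /= mulnC card_fset_sum1 big_distrl /=.
rewrite big_seq [RHS]big_seq; apply: eq_bigr => e /nbr_edgesP.
move=> [a [b [xa xb ab ->]]]; rewrite mul1n.
have -> : 2%N = #|` [fset a; b]%fset|.
  rewrite cardfs2; suff -> : a != b by [].
  by apply: contraTneq ab => ->; rewrite adj_irr.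
have -> : [fset a; b]%fset = [fset y in nbrs G x | y \in [fset a; b]]%fset.
  apply/fsetP => y; rewrite !inE /= in_nbrs.
  by case: orP => [[]/eqP->|]; rewrite ?xa ?xb ?andbF.
rewrite card_fset_sum1 -big_fset_condE /= [RHS]big_mkcond /=.
rewrite big_seq [RHS]big_seq; apply: eq_bigr => y; rewrite !inE in_nbrs => ->.
by case: ifP.
Qed.

(** For [d_x >= 2] this is the double count divided by ['C(d_x, 2)].  For
    [d_x <= 1] both sides vanish under the convention [0^-1 = 0], as then no
    edge joins two neighbours of [x]. *)
Lemma clustering_common_nbrs (R : realType) x :
  ((deg G x)%:R - 1) * clustering G R x
  = (\sum_(y <- nbrs G x) #|` common_nbrs x y|)%:R / (deg G x)%:R.
Proof.
have le_d : (2 * #|` nbr_edges G x| <= deg G x * (deg G x).-1)%N.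
  rewrite -sum_card_common_nbrs /deg card_fset_sum1 big_distrl /=.
  rewrite big_seq [leqRHS]big_seq; apply: leq_sum => y xy.
  by rewrite mul1n -card_fset_sum1 card_common_nbrs_le.
rewrite sum_card_common_nbrs /clustering.
have C2 : ('C(deg G x, 2) * 2 = deg G x * (deg G x).-1)%N.
  by rewrite -[2%N]/(2`!) bin_ffact ffactnS ffactn1.
case: (deg G x) le_d C2 => [|[|d]] /=.
- by rewrite mul0n leqn0 muln_eq0 /= => /eqP -> _; rewrite !mul0r mulr0.
- by rewrite muln0 leqn0 muln_eq0 /= => /eqP -> _; rewrite !mul0r mulr0.
move=> _ C2; have C2R : 'C(d.+2, 2)%:R * 2 = d.+2%:R * d.+1%:R :> R.
  by rewrite -!natrM C2.
have C0 : 'C(d.+2, 2)%:R != 0 :> R by rewrite pnatr_eq0 -lt0n bin_gt0.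
have d0 : d.+2%:R != 0 :> R by rewrite pnatr_eq0.
have -> : d.+2%:R - 1 = d.+1%:R :> R by rewrite -[d.+2%:R]natr1 addrK.
rewrite natrM mulrA; apply/eqP; rewrite eqr_div //; apply/eqP.
by rewrite mulrAC [d.+1%:R * _]mulrC -C2R -mulrA mulrC.
Qed.

Context (R : realType).
Local Notation m := (nbr_measure G R).

Lemma nbr_measure_ge0 x u : 0 <= m x u.
Proof. by rewrite /nbr_measure; case: ifP => _; rewrite ?invr_ge0. Qed.

Lemma nbr_measure_supp x u : u \notin nbrs G x -> m x u = 0.
Proof. by rewrite in_nbrs /nbr_measure => /negbTE ->. Qed.

Lemma sum_nbr_measure x (C : {fset V}) :
  (0 < deg G x)%N -> (nbrs G x `<=` C)%fset -> \sum_(u <- C) m x u = 1.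
Proof.
move=> d0 xC; rewrite -(big_fset_incl _ xC) /=; last first.
  by move=> u _; exact: nbr_measure_supp.
rewrite big_seq (eq_bigr (fun=> (deg G x)%:R^-1)) -?big_seq; last first.
  by move=> u; rewrite in_nbrs /nbr_measure => ->.
rewrite big_const_seq count_predT iter_addr_0 -/(deg G x).
by rewrite -[_ *+ deg G x]mulr_natr mulVf // pnatr_eq0 -lt0n.
Qed.

(** On a common neighbour the smaller of [1 / d_x] and [1 / d_y] is the inverse
    of the larger degree. *)
Lemma sum_min_nbr_measure x y (C : {fset V}) :
  (0 < deg G x)%N -> (0 < deg G y)%N -> (common_nbrs x y `<=` C)%fset ->
  \sum_(u <- C) Num.min (m x u) (m y u)
  = #|` common_nbrs x y|%:R / (maxn (deg G x) (deg G y))%:R.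
Proof.
move=> dx dy xyC; rewrite -(big_fset_incl _ xyC) /=; last first.
  move=> u _; rewrite in_fsetI negb_and => /orP[]/nbr_measure_supp ->.
    by rewrite min_l ?nbr_measure_ge0.
  by rewrite min_r ?nbr_measure_ge0.
rewrite big_seq (eq_bigr (fun=> (maxn (deg G x) (deg G y))%:R^-1)) -?big_seq.
  by rewrite big_const_seq count_predT iter_addr_0 mulr_natl.
move=> u; rewrite !inE !in_nbrs /nbr_measure => /andP[-> ->].
have [xy|/ltnW yx] := leqP (deg G x) (deg G y).
  by rewrite min_r // lef_pV2 ?ler_nat ?posrE ?ltr0n.
by rewrite min_l // lef_pV2 ?ler_nat ?posrE ?ltr0n.
Qed.

(** The overlap estimates of the transport cost; the constant 3 is the length
    of a walk [u, x, y, v] from a neighbour of [x] to a neighbour of [y]. *)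
Lemma curvature_bounds x y : adj G x y ->
  let overlap : R := #|` common_nbrs x y|%:R / (maxn (deg G x) (deg G y))%:R in
  ((- 2 + 3 * overlap)%:E <= curvature G R x y)%E
  /\ (curvature G R x y <= overlap%:E)%E.
Proof.
move=> xy /=; set ov := _ / _.
have yx : adj G y x by rewrite adj_sym.
have dx := deg_gt0 xy; have dy := deg_gt0 yx.
have dist1 : dist G x y = 1%N.
  apply/eqP; rewrite eqn_leq (@dist_le _ G x [:: y]) /= ?xy // dist_gt0 //.
  by apply: contraTneq xy => ->; rewrite adj_irr.
rewrite /curvature dist1 invr1 mule1.
pose C := (nbrs G x `|` nbrs G y)%fset.
have xC : (nbrs G x `<=` C)%fset by exact: fsubsetUl.
have yC : (nbrs G y `<=` C)%fset by exact: fsubsetUr.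
have supp z : (nbrs G z `<=` C)%fset -> forall u, u \notin C -> m z u = 0.
  by move=> /fsubsetP zC u uC; apply: nbr_measure_supp; apply: contra uC => /zC.
have ovC : \sum_(u <- C) Num.min (m x u) (m y u) = ov.
  by rewrite sum_min_nbr_measure // (fsubset_trans (fsubsetIl _ _)).
have Wle : (W1 G (m x) (m y) <= (3 * (1 - ov))%:E)%E.
  rewrite -ovC; apply: W1_le; rewrite ?sum_nbr_measure //;
    try exact: nbr_measure_ge0; try exact: supp.
  move=> u v xu yv; rewrite ler_nat.
  have xu' : adj G x u.
    by rewrite -in_nbrs; apply: contraNT xu => /nbr_measure_supp ->.
  have yv' : adj G y v.
    by rewrite -in_nbrs; apply: contraNT yv => /nbr_measure_supp ->.
  by apply: (@dist_le _ G u [:: x; y; v]); rewrite /= adj_sym xu' xy yv'.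
have Wge : ((1 - ov)%:E <= W1 G (m x) (m y))%E.
  rewrite -ovC; apply: W1_ge; try exact: nbr_measure_ge0.
  by move=> u uC; rewrite !supp // minxx.
case: (W1 G (m x) (m y)) Wle Wge => [w| |] //=; rewrite !lee_fin => w1 w2.
by split; lra.
Qed.

End Curvature.

Theorem corollary1 (R : realType) (V : choiceType) (G : graph V)
    (hG : locally_finite G) (x : V) :
  ((((deg G x)%:R - 1) / (deg G x)%:R * clustering G R x)%:E
     >= scalar_curvature G R x)%E /\
  (scalar_curvature G R x
     >= (- 2 + ((deg G x)%:R - 1) / (maxn (deg G x) (max_nbr_deg G x))%:R
               * clustering G R x)%:E)%E.
Proof.
set M := maxn _ _.
have cE (n : R) : ((deg G x)%:R - 1) / n * clustering G R x
    = (\sum_(y <- nbrs G x) #|` common_nbrs G x y|)%:R / (deg G x)%:R / n.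
  by rewrite mulrAC clustering_common_nbrs.
rewrite !cE /scalar_curvature.
have d_ge0 : (0 <= ((deg G x)%:R^-1 : R)%:E)%E by rewrite lee_fin invr_ge0.
split.
  rewrite natr_sum -mulrA mulrC -mulrA EFinM lee_wpmul2l //.
  rewrite mulrC mulr_suml -sumEFin big_seq [leRHS]big_seq; apply: lee_sum => y.
  rewrite in_nbrs // => xy.
  have [_ /le_trans] := curvature_bounds hG R xy; apply.
  have dx := deg_gt0 hG xy.
  rewrite lee_fin ler_wpM2l // lef_pV2 ?ler_nat ?posrE ?ltr0n ?leq_maxl //.
  by rewrite leq_max dx.
(* An isolated vertex has curvature 0, and cannot be averaged over. *)
have [d0|dx] := posnP (deg G x).
  rewrite d0 invr0 mulr0 mul0r addr0 mul0e lee_fin; lra.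
apply: le_trans (_ : ((deg G x)%:R^-1%:E *
   \sum_(y <- nbrs G x) (- 2 + #|` common_nbrs G x y|%:R / M%:R)%:E)%E <= _)%E.
  rewrite sumEFin -EFinM lee_fin big_split /= -mulr_suml -natr_sum.
  rewrite big_const_seq count_predT iter_addr_0 -/(deg G x).
  rewrite mulrDr -[(- 2) *+ _]mulr_natr mulrCA mulVf ?pnatr_eq0 -?lt0n // mulr1.
  by rewrite mulrA [_^-1 * _]mulrC.
rewrite lee_wpmul2l // big_seq [leRHS]big_seq; apply: lee_sum => y xy.
have xy' : adj G x y by rewrite -in_nbrs.
have [/(le_trans _) + _] := curvature_bounds hG R xy'; apply.
rewrite lee_fin lerD2l.
set c : R := #|` _|%:R.
have c0 : 0 <= c by rewrite ler0n.
apply: (@le_trans _ _ (c / (maxn (deg G x) (deg G y))%:R)).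
  have le_M : (maxn (deg G x) (deg G y) <= M)%N.
    rewrite geq_max leq_maxl /= leq_max; apply/orP; right.
    by rewrite /max_nbr_deg; apply: leq_bigmax_seq.
  have m0 : (0 < maxn (deg G x) (deg G y))%N by rewrite leq_max dx.
  by rewrite ler_wpM2l // lef_pV2 ?ler_nat ?posrE ?ltr0n // (leq_trans m0).
have : 0 <= c / (maxn (deg G x) (deg G y))%:R by rewrite divr_ge0.
by lra.
Qed.
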